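(* Let $\mathcal{H}$ be a normed space, let $n\ge 1$ be an integer, and let $c_B$ ($B\subseteq\overline{n}$) be real numbers such that $c_B\neq 0$ for some $B\neq\emptyset$. If the identity $$\sum_{B\subseteq\overline{n}} c_B\|x_B\|^2=0$$ holds for all $x_1,\dots,x_n\in\mathcal{H}$, then the norm of $\mathcal{H}$ is given by an inner product.
   Context: $\overline{n}=\{1,2,\dots,n\}$. For $B\subseteq\overline{n}$, $x_B=\sum_{i\in B}x_i$ (so $x_\emptyset=0$). The norm is given by an inner product if there is an inner product $\langle\cdot,\cdot\rangle$ on $\mathcal{H}$ with $\|x\|^2=\langle x,x\rangle$ for all $x\in\mathcal{H}$. *)

(* Defs.v *)
From mathcomp Require Import all_boot all_order all_algebra.
From mathcomp Require Import reals normedtype.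

Import GRing.Theory Num.Theory.
Local Open Scope ring_scope.

(* [conj] is the conjugation of the scalars: [idfun] for real scalars, complex
   conjugation for complex ones.  [{dot H for conj}] is the type of positive
   definite hermitian forms, linear in the first argument. *)
Definition norm_given_by_inner_product (K : numFieldType) (conj : K -> K)
    (H : normedModType K) : Prop :=
  exists ip : {dot H for conj}, forall x : H, `|x| ^+ 2 = ip x x.

(* Main.v *)
Require Import Defs.
From HB Require Import structures.
From mathcomp Require Import all_boot all_order all_algebra.
From mathcomp Require Import reals normedtype complex.
From mathcomp Require Import ring lra.

Import Order.TTheory GRing.Theory Num.Theory.
Local Open Scope ring_scope.
Local Open Scope complex_scope.

(** Write [f x] for the squared norm of [x].  The proof shows that [f] is a
    polynomial map of degree at most 2 in the sense of Frechet, that is, that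
    all its third differences vanish; the polar form of [f] is then the inner
    product.

    Among the subsets [B] with [c B != 0] take one of maximal size, say of size
    [m.+1].  Taking differences of the identity successively in the variables
    indexed by [B] kills each term whose index set misses an element of [B],
    and every strictly larger index set has coefficient 0; what remains says
    that the differences of order [m.+1] of [f] at the origin vanish
    ([identity_diff_vanish]), hence that they vanish at every point
    ([diff_vanish_base0]).

    If all differences of order [m.+4] vanish, then those of order [m.+3] are
    additive in each increment, so multiplying three of the increments by [k]
    multiplies such a difference by [k ^ 3].  But [f] grows quadratically, so
    the difference is at most a constant times [k ^ 2], and it must be 0
    ([diff_vanish_pred]).  The order thus descends to 3, where the vanishing of
    the differences at 0 is exactly the additivity of the polar form
    [x, y |-> (f (x + y) - f x - f y) / 2] in each variable ([polarDl]).  That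
    form is bounded in terms of the norms of its arguments, so additivity
    upgrades to real linearity ([additive_bounded_linear], [polar_line]).

    Over the complex numbers the same real form [b] is obtained from the
    real-valued norm, it is invariant under multiplication of both arguments by
    ['i], and [b x y + 'i * b x ('i y)] is the required hermitian form
    ([dot_of_complex_polar]). *)

Set Implicit Arguments.
Unset Strict Implicit.

(** * Iterated differences *)

Section IteratedDifferences.
Variables (R : comNzRingType) (V : zmodType).
Implicit Types (f : V -> R) (s : seq V) (u x y z : V).

Fixpoint diff f s u : R :=
  if s is h :: s' then diff f s' (u + h) - diff f s' u else f u.

Lemma diff_cons f h s u : diff f (h :: s) u = diff f s (u + h) - diff f s u.
Proof. by []. Qed.

Lemma diff_mem0 f s u : 0 \in s -> diff f s u = 0.
Proof.
elim: s u => //= h s IHs u; rewrite inE => /predU1P[<-|s0].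
  by rewrite addr0 subrr.
by rewrite !IHs // subrr.
Qed.

Lemma diff_swap f x y s u : diff f [:: x, y & s] u = diff f [:: y, x & s] u.
Proof. by rewrite !diff_cons (addrAC u y x); ring. Qed.

Lemma diff_rot f x y z s u :
  diff f [:: x, y, z & s] u = diff f [:: z, x, y & s] u.
Proof.
by rewrite (diff_swap _ z x) [LHS]diff_cons [RHS]diff_cons !(diff_swap _ y z).
Qed.

Definition diff_vanish f m := forall s u, size s = m -> diff f s u = 0.

(** A difference at [0] with increments [v :: s] compares the differences at
    [v] and at [0] with increments [s].  So if the differences of order [m.+1]
    vanish at [0], those of order [m] do not depend on the point, and their own
    differences vanish everywhere. *)
Lemma diff_vanish_base0 f m :
  (forall s, size s = m.+1 -> diff f s 0 = 0) -> diff_vanish f m.+1.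
Proof.
move=> f0 [//|h s] u [sz] /=.
have E v : diff f s v = diff f s 0.
  have := f0 (v :: s); rewrite /= sz add0r => /(_ erefl) /eqP.
  by rewrite subr_eq0 => /eqP.
by rewrite !E subrr.
Qed.

Lemma diff_vanishS f m : diff_vanish f m -> diff_vanish f m.+1.
Proof. by move=> f0 [//|h s] u [sz]; rewrite diff_cons !f0 // subrr. Qed.

(** The defect of additivity in the first increment is the difference with
    increments [[:: x, y & s]], whose order is one higher. *)
Lemma diffD_head f m s x y u :
  diff_vanish f m.+2 -> size s = m ->
  diff f (x + y :: s) u = diff f (x :: s) u + diff f (y :: s) u.
Proof.
move=> f0 sz; have := f0 [:: x, y & s] u.
rewrite /= sz => /(_ erefl)/eqP; rewrite subr_eq0 => /eqP E.
by rewrite -E addrA [RHS]addrC subrKA addrC.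
Qed.

Lemma diffMn_head f m s x u k :
  diff_vanish f m.+2 -> size s = m ->
  diff f (x *+ k :: s) u = diff f (x :: s) u *+ k.
Proof.
move=> f0 sz; elim: k => [|k IHk]; first by rewrite !mulr0n diff_mem0 ?mem_head.
by rewrite !mulrS (@diffD_head _ m) // IHk.
Qed.

Lemma diffMn3 f m s x y z u k :
  diff_vanish f m.+4 -> size s = m ->
  diff f [:: x *+ k, y *+ k, z *+ k & s] u
    = diff f [:: x, y, z & s] u *+ k *+ k *+ k.
Proof.
move=> f0 sz.
rewrite (@diffMn_head _ m.+2) /= ?sz // -!diff_cons diff_rot.
rewrite (@diffMn_head _ m.+2) /= ?sz // -!diff_cons diff_rot.
by rewrite (@diffMn_head _ m.+2) /= ?sz // -!diff_cons diff_rot.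
Qed.

(** The identity differenced in the variables listed by [l]: moving the
    variable [j] by [x j] moves the sum over [B] by [x j] when [B] contains [j]
    and leaves it unchanged otherwise, whence the increment 0. *)
Lemma diff_identity n (c : {set 'I_n} -> R) f :
  (forall x : 'I_n -> V,
     \sum_(B : {set 'I_n}) c B * f (\sum_(i in B) x i) = 0) ->
  forall (x y : 'I_n -> V) (l : seq 'I_n),
  \sum_(B : {set 'I_n})
    c B * diff f [seq if i \in B then x i else 0 | i <- l] (\sum_(i in B) y i)
  = 0.
Proof.
move=> f0 x y l; elim: l y => [|j l IHl] y; first exact: f0.
under eq_bigr => B _ do rewrite /= mulrBr.
rewrite sumrB (IHl y) subr0.
rewrite -[RHS](IHl (fun i => y i + if i == j then x i else 0)).
apply: eq_bigr => B _; rewrite big_split; congr (_ * diff _ _ (_ + _)).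
rewrite big_mkcond (bigD1 j) //= eqxx big1 ?addr0 // => i /negPf->.
by rewrite if_same.
Qed.
End IteratedDifferences.

(** The differences are taken along a set [B] of maximal size with [c B != 0].
    Every other term dies: either its index set misses some element of [B], so
    that an increment is 0, or it strictly contains [B], so that its
    coefficient is 0.  Since the point is [0] and the increments are arbitrary,
    [c B] can be cancelled. *)
Lemma identity_diff_vanish (R : idomainType) (V : zmodType) n
    (c : {set 'I_n} -> R) (f : V -> R) :
  (exists B : {set 'I_n}, B != set0 /\ c B != 0) ->
  (forall x : 'I_n -> V,
     \sum_(B : {set 'I_n}) c B * f (\sum_(i in B) x i) = 0) ->
  exists m, diff_vanish f m.+1.
Proof.
move=> [B1 [B1n0 cB1]] f0.
have [/= B cB Bmax] :=
  @arg_maxnP _ B1 (fun B => c B != 0) (fun B => #|B|) cB1.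
have cardB : (0 < #|B|)%N.
  by apply: leq_trans (Bmax B1 cB1); rewrite card_gt0.
exists #|B|.-1; apply: diff_vanish_base0; rewrite prednK // => s sz.
(* The variables indexed by [B] take the prescribed increments as values. *)
pose x i := nth 0 s (index i (enum B)).
have sE : [seq x i | i <- enum B] = s.
  apply: (@eq_from_nth _ 0) => [|i]; rewrite size_map -cardE ?sz // => iB.
  have i0 : 'I_n by have := enum_default (Ordinal iB).
  by rewrite (nth_map i0) -?cardE // /x index_uniq ?enum_uniq // -cardE.
have := diff_identity f0 x (fun=> 0) (enum B).
rewrite (bigD1 B) //= [X in _ + X]big1 => [|C neqCB].
  rewrite addr0 big1 // => /eqP; rewrite mulf_eq0 (negPf cB) /= => /eqP <-.
  rewrite -[in LHS]sE; congr diff.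
  by apply/eq_in_map => i; rewrite mem_enum => ->.
have [BC|] := boolP (B \subset C); last first.
  case/subsetPn=> i iB iC; rewrite diff_mem0 ?mulr0 //.
  by apply/mapP; exists i; rewrite ?mem_enum // (negPf iC).
have [->|/Bmax] := eqVneq (c C) 0; first by rewrite mul0r.
by rewrite leqNgt proper_card // properEneq eq_sym neqCB.
Qed.

(** * Lowering the order to three by growth *)

Lemma archi_le0 (R : archiRealFieldType) (a C : R) :
  (forall k, a *+ k <= C) -> a <= 0.
Proof.
move=> aC; rewrite leNgt; apply/negP => a0.
have C0 : 0 <= C by have := aC 0%N.
have := archi_boundP (divr_ge0 C0 (ltW a0)).
by rewrite ltr_pdivrMr // mulr_natl ltNge aC.
Qed.

(** Real and complex normed spaces are treated together: all that matters here
    is a real-valued function [N] on an abelian group that is nonnegative,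
    subadditive and homogeneous for natural multiples. *)
Section NormSquare.
Variables (R : archiRealFieldType) (V : zmodType) (N : V -> R).
Hypothesis N_ge0 : forall x, 0 <= N x.
Hypothesis ler_ND : forall x y, N (x + y) <= N x + N y.
Hypothesis NMn : forall x k, N (x *+ k) = N x *+ k.
Implicit Types (s : seq V) (u x y z : V).

Let f x := N x ^+ 2.

Lemma norm_diff_le s u :
  `|diff f s u| <= 2 ^+ size s * (N u + \sum_(h <- s) N h) ^+ 2.
Proof.
elim: s u => [|h s IHs] u.
  by rewrite /= big_nil addr0 mul1r ger0_norm // sqr_ge0.
rewrite diff_cons big_cons /= (exprS 2) -[2 * _ * _]mulrA mulr_natl.
apply: le_trans (ler_normB _ _) _; rewrite mulr2n.
have S0 : 0 <= \sum_(h <- s) N h by apply: sumr_ge0.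
apply: lerD; apply: le_trans (IHs _) _;
  rewrite ler_wpM2l ?exprn_ge0 // ?ler0n //.
  by rewrite lerXn2r ?nnegrE ?addr_ge0 // addrA lerD2r.
by rewrite lerXn2r ?nnegrE ?addr_ge0 // lerD2l lerDr.
Qed.

(** Scaling three increments by [k] multiplies the difference by [k ^ 3], while
    [norm_diff_le] allows growth by a factor [k ^ 2] only. *)
Lemma diff_vanish_pred m : diff_vanish f m.+4 -> diff_vanish f m.+3.
Proof.
move=> f0 [//|x [//|y [//|z s]]] u [sz].
set d := diff _ _ _; apply/eqP; rewrite -normr_le0.
pose C : R := 2 ^+ m.+3 * (N u + \sum_(h <- [:: x, y, z & s]) N h) ^+ 2.
apply: (@archi_le0 _ _ C) => -[|k].
  by rewrite mulr0n mulr_ge0 ?sqr_ge0 ?exprn_ge0 ?ler0n.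
have k0 : 0 < k.+1%:R ^+ 2 :> R by rewrite exprn_gt0 // ltr0Sn.
rewrite -(ler_pM2r k0) /C.
have := norm_diff_le [:: x *+ k.+1, y *+ k.+1, z *+ k.+1 & s] u.
rewrite (diffMn3 x y z u k.+1 f0 sz) -/d /= sz !normrMn => le1.
have -> : `|d| *+ k.+1 * k.+1%:R ^+ 2 = `|d| *+ k.+1 *+ k.+1 *+ k.+1.
  by rewrite expr2 mulrA !mulr_natr.
apply: le_trans le1 _; rewrite -[leRHS](mulrA (2 ^+ m.+3)) -exprMn.
rewrite ler_wpM2l ?exprn_ge0 ?ler0n //.
have S0 : 0 <= \sum_(h <- s) N h by apply: sumr_ge0.
rewrite !big_cons !NMn.
rewrite lerXn2r ?nnegrE ?mulr_ge0 ?addr_ge0 ?mulrn_wge0 ?ler0n //.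
(* The point [u] and the other increments are not scaled, which is harmless
   because [1 <= k.+1]. *)
rewrite mulr_natr !mulrnDl !lerD //.
  by rewrite -{1}[N u]mulr1n ler_wpMn2l.
by rewrite -{1}[X in X <= _]mulr1n ler_wpMn2l.
Qed.

Lemma diff_vanish3 m : diff_vanish f m -> diff_vanish f 3.
Proof.
move=> f0; have {f0} : diff_vanish f m.+3 by do 3!apply: diff_vanishS.
by elim: m => // m IHm /diff_vanish_pred.
Qed.

Lemma identity_diff_vanish3 n (c : {set 'I_n} -> R) :
  (exists B : {set 'I_n}, B != set0 /\ c B != 0) ->
  (forall x : 'I_n -> V,
     \sum_(B : {set 'I_n}) c B * N (\sum_(i in B) x i) ^+ 2 = 0) ->
  diff_vanish f 3.
Proof.
move=> cB idN; have [m fm] := identity_diff_vanish (f := f) cB idN.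
exact: diff_vanish3 fm.
Qed.
End NormSquare.

(** * The polar form *)

(** The defect [g a - a * g 1] is additive and vanishes at the integers, so it
    is periodic of period 1 and hence bounded on the whole line; a bounded
    additive function is 0. *)
Lemma additive_bounded_linear (R : archiRealFieldType) (g : R -> R) (C : R) :
  (forall a b, g (a + b) = g a + g b) ->
  (forall a, 0 <= a <= 1 -> `|g a| <= C) ->
  forall a, g a = a * g 1.
Proof.
move=> gD gC a; pose h a := g a - a * g 1.
have hB : zmod_morphism h.
  move=> b b'; rewrite /h; have := gD (b - b') b'; rewrite subrK => ->.
  by ring.
pose hM := GRing.isZmodMorphism.Build R R h hB.
pose H : {additive R -> R} := HB.pack h hM.
suff : H a = 0 by move/eqP; rewrite subr_eq0 => /eqP.
have HC b : `|H b| <= C + `|g 1|.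
  have /andP[le1 lt1] := floor_itv b.
  have -> : H b = H (b - (Num.floor b)%:~R).
    by rewrite raddfB raddfMz /= /h mul1r subrr mul0rz subr0.
  set r := b - _; have r01 : 0 <= r <= 1.
    by rewrite subr_ge0 le1 lerBlDl ltW // -[1]/(1%:~R) -intrD.
  apply: le_trans (ler_normB _ _) _; rewrite lerD ?gC // normrM ler_piMl //.
  by case/andP: r01 => r0 r1; rewrite ger0_norm.
apply/eqP; rewrite -normr_le0; apply: (@archi_le0 _ _ (C + `|g 1|)) => k.
by rewrite -normrMn -raddfMn.
Qed.

Definition polar (R : fieldType) (V : zmodType) (f : V -> R) (x y : V) :=
  (f (x + y) - f x - f y) / 2.

Section Polar.
Variables (R : archiRealFieldType) (V : zmodType) (N : V -> R).
Hypothesis N_ge0 : forall x, 0 <= N x.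
Hypothesis ler_ND : forall x y, N (x + y) <= N x + N y.
Hypothesis NMn : forall x k, N (x *+ k) = N x *+ k.
Let f x := N x ^+ 2.
Hypothesis f0 : diff_vanish f 3.
Local Notation b := (polar f).

Let N0 : N 0 = 0.
Proof. by rewrite -[X in N X](mulr0n 0) NMn mulr0n. Qed.

Lemma polarC x y : b x y = b y x.
Proof. by rewrite /polar [y + x]addrC addrAC. Qed.

(** Twice the defect of additivity is the third difference of [f] at 0 with
    increments [x], [x'] and [y]. *)
Lemma polarDl x x' y : b (x + x') y = b x y + b x' y.
Proof.
have /= := @f0 [:: x; x'; y] 0 erefl; rewrite !add0r => E.
have fz : f 0 = 0 by rewrite /f N0 expr0n.
by rewrite /polar -mulrDl; congr (_ / _); move: E; rewrite fz; lra.
Qed.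

Lemma polar_id x : b x x = f x.
Proof. by rewrite /polar /f -mulr2n NMn; field. Qed.

Lemma polar_le x y : `|b x y| <= (N x + N y) ^+ 2.
Proof.
rewrite /polar /f.
have := ler_ND x y; have := N_ge0 (x + y); have := N_ge0 x; have := N_ge0 y.
move=> y0 x0 xy0 le; rewrite ler_norml; apply/andP; split; nra.
Qed.

(** Real homogeneity of the polar form along a real line [phi] of [V].  The
    line is a parameter because [V] is only an abelian group: a complex space
    supplies [t |-> t%:C *: x]. *)
Lemma polar_line (phi : R -> V) y a :
  (forall a a', phi (a + a') = phi a + phi a') ->
  (forall a, N (phi a) = `|a| * N (phi 1)) ->
  b (phi a) y = a * b (phi 1) y.
Proof.
move=> phiD Nphi.
pose C := (N (phi 1) + N y) ^+ 2.
apply: (@additive_bounded_linear _ (fun a => b (phi a) y) C).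
  by move=> a1 a2; rewrite phiD polarDl.
move=> t /andP[t0 t1]; apply: le_trans (polar_le _ _) _.
rewrite lerXn2r ?nnegrE ?addr_ge0 // lerD2r Nphi ler_piMl //.
by rewrite ger0_norm.
Qed.
End Polar.

(** * Inner products *)

Lemma dot_of_left_linear (K : numFieldType) (conj : {rmorphism K -> K})
    (H : normedModType K) (ip : H -> H -> K) :
  (forall x x' y, ip (x + x') y = ip x y + ip x' y) ->
  (forall a x y, ip (a *: x) y = a * ip x y) ->
  (forall x y, ip x y = conj (ip y x)) ->
  (forall x, `|x| ^+ 2 = ip x x) ->
  norm_given_by_inner_product K conj H.
Proof.
move=> ipD ipZ ipC ipE.
have ipBl y : zmod_morphism (ip^~ y).
  by move=> x x'; apply/eqP; rewrite eq_sym subr_eq -ipD subrK.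
have ipBr x : zmod_morphism (ip x).
  by move=> y y'; rewrite ipC ipBl rmorphB -!ipC.
have ipZr x : scalable_for (conj \; *%R) (ip x).
  by move=> a y; rewrite ipC ipZ rmorphM -ipC.
have ip0 x : x != 0 -> 0 < ip x x.
  by move=> x0; rewrite -ipE exprn_gt0 // normr_gt0.
pose bm := isBilinear.Build K H H K *%R (conj \; *%R) ip ipBl ipBr
  (fun y a x => ipZ a x y) ipZr.
have ipC' x y : ip x y = (-1) ^+ false * conj (ip y x) by rewrite mul1r -ipC.
pose hm := isHermitianSesquilinear.Build K H false conj ip ipC'.
pose dm := isDotProduct.Build K H ip ip0.
pose D : {dot H for conj} := HB.pack ip bm hm dm.
by exists D.
Qed.

(** A real inner product [b] for which multiplication by ['i] is an isometry is
    the real part of a hermitian one; as the form is to be linear in its first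
    argument, its imaginary part is [b x ('i y)]. *)
Lemma dot_of_complex_polar (R : realType) (H : normedModType R[i])
    (b : H -> H -> R) :
  (forall x y, b x y = b y x) ->
  (forall x x' y, b (x + x') y = b x y + b x' y) ->
  (forall t x y, b (t%:C *: x) y = t * b x y) ->
  (forall x y, b ('i *: x) ('i *: y) = b x y) ->
  (forall x, `|x| ^+ 2 = (b x x)%:C) ->
  norm_given_by_inner_product R[i] Num.conj H.
Proof.
move=> bC bDl bZl bi bE.
have bN x y : b (- x) y = - b x y.
  by have := bZl (-1) x y; rewrite rmorphN rmorph1 scaleN1r mulN1r.
have bil x y : b ('i *: x) y = - b x ('i *: y).
  by rewrite -bi scalerA -expr2 sqrCi scaleN1r bN.
pose ip x y := (b x y)%:C + 'i * (b x ('i *: y))%:C.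
have ipD x x' y : ip (x + x') y = ip x y + ip x' y.
  by rewrite /ip !bDl !rmorphD /=; ring.
apply: (@dot_of_left_linear _ Num.conj _ ip) => //.
- move=> a x y.
  have ipR (t : R) z : ip (t%:C *: z) y = t%:C * ip z y.
    by rewrite /ip !bZl !rmorphM /=; ring.
  have ipI z : ip ('i *: z) y = 'i * ip z y.
    rewrite /ip bi bil rmorphN /= mulrDr mulrA -expr2 sqrCi; ring.
  have [r [s ->]] : exists r s : R, a = r%:C + 'i * s%:C.
    by exists (complex.Re a), (complex.Im a); exact: complexE.
  by rewrite scalerDl -scalerA ipD ipI !ipR; ring.
- move=> x y; rewrite /ip rmorphD rmorphM /= conjCi.
  have RC (t : R) : ((t%:C)^* = t%:C)%R by rewrite conj_Creal // complex_real.
  by rewrite !RC (bC y x) (bC y) bil rmorphN /=; ring.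
- move=> x; rewrite /ip.
  have -> : b x ('i *: x) = 0 by have := bil x x; rewrite bC; lra.
  by rewrite mulr0 addr0 bE.
Qed.

Unset Implicit Arguments.
Set Strict Implicit.

Theorem theorem4p3 (R : realType) (n : nat) (c : {set 'I_n} -> R) :
  (1 <= n)%N ->
  (exists B : {set 'I_n}, B != set0 /\ c B != 0) ->
  (forall H : normedModType R,
     (forall x : 'I_n -> H,
        \sum_(B : {set 'I_n}) c B * `|\sum_(i in B) x i| ^+ 2 = 0) ->
     @norm_given_by_inner_product R idfun H) /\
  (forall H : normedModType R[i],
     (forall x : 'I_n -> H,
        \sum_(B : {set 'I_n}) (c B)%:C * `|\sum_(i in B) x i| ^+ 2 = 0) ->
     @norm_given_by_inner_product R[i] Num.conj H).
Proof.
move=> _ cB; split=> H idH.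
  pose N (x : H) := `|x|.
  have N_ge0 x : 0 <= N x by exact: normr_ge0.
  have ler_ND x y : N (x + y) <= N x + N y by exact: ler_normD.
  have NMn x k : N (x *+ k) = N x *+ k by exact: normrMn.
  have f3 := identity_diff_vanish3 N_ge0 ler_ND NMn cB idH.
  apply: (@dot_of_left_linear _ idfun _ (polar (fun x => N x ^+ 2))).
  - by move=> x x' y; apply: polarDl.
  - move=> a x y; rewrite -[x in RHS]scale1r.
    apply: (polar_line N_ge0 ler_ND NMn f3 (phi := fun t => t *: x)).
      by move=> *; rewrite scalerDl.
    by move=> t; rewrite /N !normrZ normr1 mul1r.
  - by move=> x y; rewrite polarC.
  - by move=> x; rewrite polar_id.
(* The norm of a complex space takes its values in [R[i]]; [N] is the same norm
   with values in [R]. *)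
pose N (x : H) := complex.Re `|x|.
have NE x : `|x| = (N x)%:C by rewrite /N RRe_real // normr_real.
have CI : injective (real_complex R) by exact: fmorph_inj.
have N_ge0 x : 0 <= N x by rewrite -lecR -NE; exact: normr_ge0.
have ler_ND x y : N (x + y) <= N x + N y.
  by rewrite -lecR rmorphD /= -!NE; apply: ler_normD.
have NMn x k : N (x *+ k) = N x *+ k.
  by apply: CI; rewrite rmorphMn /= -!NE; apply: normrMn.
have NZ (t : R[i]) x : (N (t *: x))%:C = `|t| * (N x)%:C by rewrite -!NE normrZ.
have idN (x : 'I_n -> H) :
    \sum_(B : {set 'I_n}) c B * N (\sum_(i in B) x i) ^+ 2 = 0.
  apply: CI; rewrite rmorph0 rmorph_sum -[RHS](idH x); apply: eq_bigr => B _.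
  by rewrite rmorphM rmorphXn /= -NE.
have f3 := identity_diff_vanish3 N_ge0 ler_ND NMn cB idN.
apply: (@dot_of_complex_polar _ _ (polar (fun x => N x ^+ 2))).
- by move=> x y; exact: polarC.
- by move=> x x' y; exact: polarDl.
- move=> t x y; rewrite -[x in RHS]scale1r.
  apply: (polar_line N_ge0 ler_ND NMn f3 (phi := fun t => t%:C *: x)).
    by move=> s s'; rewrite rmorphD scalerDl.
  move=> s; apply: CI; rewrite rmorphM /= !NZ normr1 mul1r.
  by rewrite normc_def /= expr0n addr0 sqrtr_sqr.
- have Ni x : N ('i *: x) = N x by apply: CI; rewrite NZ normCi mul1r.
  by move=> x y; rewrite /polar -scalerDr !Ni.
- by move=> x; rewrite polar_id // NE -rmorphXn.
Qed.
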